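(* Let $\Gamma$ be a right-angled Coxeter group on $k$ generators. Then $\Gamma$ admits a properly discontinuous action by affine transformations on $\mathbb{R}^{k(k-1)/2}$.
   Context: A right-angled Coxeter group on $k$ generators is a group with a presentation $\langle \gamma_1,\dots,\gamma_k \mid (\gamma_i\gamma_j)^{m_{i,j}}=1\ \forall i,j\rangle$, where $m_{i,i}=1$ and $m_{i,j}=m_{j,i}\in\{2,\infty\}$ for $i\neq j$ (no relation when $m_{i,j}=\infty$). A proper affine action of a discrete group $\Gamma$ on $\mathbb{R}^n$ is a homomorphism from $\Gamma$ to the group of affine transformations of $\mathbb{R}^n$ such that the resulting action is properly discontinuous: for every compact $\mathscr{C}\subset\mathbb{R}^n$, the set of $\gamma\in\Gamma$ with $\gamma\cdot\mathscr{C}\cap\mathscr{C}\neq\varnothing$ is finite. The action need not be cocompact. *)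

(* Defs.v *)
From HB Require Import structures.
From mathcomp Require Import all_boot all_order all_algebra.
From mathcomp Require Import all_classical all_reals all_analysis.

Set Implicit Arguments.
Unset Strict Implicit.
Unset Printing Implicit Defensive.

Import Order.TTheory GRing.Theory Num.Theory.
Import numFieldNormedType.Exports.

Local Open Scope classical_set_scope.
Local Open Scope ring_scope.

(* Words in the letters x_i and x_i^-1, representing elements of the free group
   on I: (i, true) stands for x_i and (i, false) for x_i^-1. *)
Definition fword (I : Type) : Type := seq (I * bool).

Definition eval_fword (I : Type) (G : groupType) (gen : I -> G) (w : fword I)
    : G :=
  (\prod_(x <- w) (if x.2 then gen x.1 else (gen x.1)^-1))%g.

(* Equality of words in the abstract group < I | rels >: u and v represent the
   same element modulo the normal closure of rels in the free group on I. *)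
Inductive pres_eq (I : Type) (rels : fword I -> Prop)
    : fword I -> fword I -> Prop :=
| pres_refl w : pres_eq rels w w
| pres_sym u v : pres_eq rels u v -> pres_eq rels v u
| pres_trans u v w : pres_eq rels u v -> pres_eq rels v w -> pres_eq rels u w
| pres_cancel u v i b :
    pres_eq rels (u ++ [:: (i, b); (i, ~~ b)] ++ v) (u ++ v)
| pres_rel u v r : rels r -> pres_eq rels (u ++ r ++ v) (u ++ v).

Definition has_presentation (I : Type) (G : groupType) (gen : I -> G)
    (rels : fword I -> Prop) : Prop :=
  (forall g : G, exists w : fword I, eval_fword gen w = g) /\
  (forall w : fword I, eval_fword gen w = 1%g <-> pres_eq rels w [::]).

(* Coxeter exponents m i j are encoded in option nat, None standing for oo. *)
Definition right_angled (k : nat) (m : 'I_k -> 'I_k -> option nat) : Prop :=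
  [/\ forall i, m i i = Some 1%N,
      forall i j, m i j = m j i
    & forall i j, i != j -> m i j = Some 2%N \/ m i j = None].

Definition coxeter_rels (k : nat) (m : 'I_k -> 'I_k -> option nat)
    (w : fword 'I_k) : Prop :=
  exists i j n,
    m i j = Some n /\ w = flatten (nseq n [:: (i, true); (j, true)]).

Definition right_angled_Coxeter_group (k : nat) (G : groupType) : Prop :=
  exists (m : 'I_k -> 'I_k -> option nat) (gen : 'I_k -> G),
    right_angled m /\ has_presentation gen (coxeter_rels m).

Definition affine_transformation (R : realType) (n : nat)
    (f : 'cV[R]_n -> 'cV[R]_n) : Prop :=
  exists (A : 'M[R]_n) (b : 'cV[R]_n),
    A \in unitmx /\ forall x, f x = A *m x + b.

(* A homomorphism from G to the group (under composition) of affine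
   transformations of R^n; rho 1 = id follows, since each rho g is bijective. *)
Definition affine_action (R : realType) (n : nat) (G : groupType)
    (rho : G -> 'cV[R]_n -> 'cV[R]_n) : Prop :=
  (forall g, affine_transformation (rho g)) /\
  (forall g h, rho (g * h)%g = rho g \o rho h).

Definition properly_discontinuous (T : topologicalType) (G : groupType)
    (rho : G -> T -> T) : Prop :=
  forall C : set T, compact C ->
    finite_set [set g : G | (rho g @` C) `&` C !=set0].

(* Main.v *)
Require Import Defs.
From HB Require Import structures.
From mathcomp Require Import all_boot all_order all_algebra.
From mathcomp Require Import all_classical all_reals all_analysis.
From mathcomp Require Import ring lra.
Import numFieldNormedType.Exports.

(** Properness comes from a first-order deformation of a reflection
    representation.  For generators that do not commute put the entry [-(3 + X)],
    for commuting ones [0], and [2] on the diagonal: this symmetric matrix [C] over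
    [{poly R}] is preserved by a representation [rho] of the group in which each
    generator acts as a reflection.  Fix a real parameter [x].  Differentiating
    [rho] at [X = x] gives an affine action

      M |-> rho(g^-1)^T M rho(g^-1) + C rho'(g) rho(g^-1)

    on bilinear forms, and since [rho] preserves [C] for all [X], the affine space
    of those [M] with [M + M^T = - C'(x)] is invariant.  It is a translate of the
    space of skew matrices, whose dimension is [k (k - 1) / 2]
    ([tangent_action_affine_action]).

    Suppose that [g] sends [M] to [N], both in a fixed compact set, that is,
    [N rho(g) = rho(g^-1)^T M + C rho'(g)].  Let [one] be the row of ones and write
    [one rho(g) = one - n C]; let [H], a polynomial in [X], be the sum of the entries
    of the row [n].  Choose [x] with [C(x)] invertible and [v] with
    [C(x) v = - one^T].  Evaluating the relation on the pair [(v, v)] turns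
    [C rho'(g)] into [H'(x)] up to terms linear in [n], and all remaining terms
    are bounded by a constant times [1 + H(x)].  So [H'(x) <= Q (1 + H(x))], with
    [Q] depending only on the compact set ([tangent_bound]).

    On the other hand [H'(x)] is much larger than [H(x)] when [g] is long.
    Computing [one rho(g)] letter by letter along a reduced word of [g^-1] is Mozes's
    numbers game: a letter fires, its value changes sign, and the values of the
    letters that do not commute with it grow.  All fired values, of which [n]
    collects the sums per letter, are polynomials with nonnegative coefficients
    ([reduced_invariant]), and they grow so fast with [X] that
    [H(1) <= 4 k sqrt(H(x))] when [x] is large ([weight_sqrt]).  The coefficients of
    [H] in degree less than [D] contribute at most [x^D H(1)] to [H(x)], which is
    negligible against [H(x)], whence [x H'(x) >= D H(x) - D x^D H(1)]
    ([deriv_horner_lower]).  With [D] larger than [x Q] this bounds [H(x)].  Each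
    letter of the word adds at least [1] to [H(x)], so the word length is bounded
    and only finitely many [g] are possible. *)

Set Implicit Arguments.
Unset Strict Implicit.
Unset Printing Implicit Defensive.

Import Order.TTheory GRing.Theory Num.Theory.

Local Open Scope ring_scope.

(** * Polynomials ordered coefficientwise *)

Definition coef_le (R : realFieldType) (p q : {poly R}) := forall n, p`_n <= q`_n.

Local Notation "p <=c q" := (coef_le p q) (at level 70) : ring_scope.

Section CoefOrder.
Variable R : realFieldType.
Implicit Types p q r : {poly R}.

Lemma coef_le_refl p : p <=c p.
Proof. by move=> n. Qed.

Lemma coef_le_trans q p r : p <=c q -> q <=c r -> p <=c r.
Proof. by move=> pq qr n; apply: le_trans (pq n) (qr n). Qed.

Lemma coef_leD p q p' q' : p <=c q -> p' <=c q' -> p + p' <=c q + q'.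
Proof. by move=> pq pq' n; rewrite !coefD lerD. Qed.

Lemma coef_subr_ge0 p q : (0 <=c q - p) <-> (p <=c q).
Proof. by split=> pq n; have := pq n; rewrite coefB coef0 subr_ge0. Qed.

Lemma coef_lerDl p q : 0 <=c q -> p <=c p + q.
Proof. by move=> q0 n; have := q0 n; rewrite coef0 coefD lerDl. Qed.

Lemma coef_addr_ge0 p q : 0 <=c p -> 0 <=c q -> 0 <=c p + q.
Proof. by move=> p0 q0; apply: coef_le_trans p0 (coef_lerDl _ q0). Qed.

Lemma coef_mulr_ge0 p q : 0 <=c p -> 0 <=c q -> 0 <=c p * q.
Proof.
move=> p0 q0 n; rewrite coefM coef0; apply: sumr_ge0 => i _.
by have := p0 i; have := q0 (n - i)%N; rewrite !coef0 => ? ?; rewrite mulr_ge0.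
Qed.

Lemma coef_ler_wpM2l r p q : 0 <=c r -> p <=c q -> r * p <=c r * q.
Proof.
move=> r0 /coef_subr_ge0 pq; apply/coef_subr_ge0; rewrite -mulrBr.
exact: coef_mulr_ge0.
Qed.

Lemma coef_nat_ge0 n : (0 : {poly R}) <=c n%:R.
Proof. by move=> i; rewrite -polyC_natr coefC coef0; case: ifP. Qed.

Lemma coef_polyX_ge0 : (0 : {poly R}) <=c 'X.
Proof. by move=> i; rewrite coefX coef0. Qed.

Lemma coef_sum_ge0 (I : finType) (Q : pred I) (F : I -> {poly R}) :
  (forall i, Q i -> 0 <=c F i) -> 0 <=c \sum_(i | Q i) F i.
Proof.
move=> F0 n; rewrite coef0 coef_sum; apply: sumr_ge0 => i Qi.
by have := F0 i Qi n; rewrite coef0.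
Qed.

Lemma coef_le_horner p q x : 0 <= x -> p <=c q -> p.[x] <= q.[x].
Proof.
move=> x0 /coef_subr_ge0 pq; rewrite -subr_ge0 -hornerN -hornerD horner_coef.
apply: sumr_ge0 => i _; rewrite mulr_ge0 ?exprn_ge0 //.
by have := pq i; rewrite coef0.
Qed.

(** Compare coefficients: in degree [i >= D] the derivative gains the factor [i], and
    in degree [i < D] the bound [x ^+ i <= x ^+ D] lets [p.[1]] absorb the term. *)
Lemma deriv_horner_lower p x D : 0 <=c p -> 1 <= x ->
  D%:R * p.[x] <= x * p^`().[x] + D%:R * x ^+ D * p.[1].
Proof.
move=> p0 x1.
have x0 : 0 <= x by lra.
have -> : x * p^`().[x] = \sum_(i < size p) p`_i * x ^+ i * i%:R.
  have -> : x * p^`().[x] = ('X * p^`()).[x] by rewrite !hornerE mulrC.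
  rewrite (@horner_coef_wide _ (size p)); last first.
    have [->|pn0] := eqVneq p 0; first by rewrite linear0 mulr0 size_poly0.
    have [->|dn0] := eqVneq p^`() 0; first by rewrite mulr0 size_poly0.
    by rewrite mulrC size_mulX // lt_size_deriv.
  apply: eq_bigr => -[[|i] /= _] _; first by rewrite coefXM /= mul0r mulr0.
  by rewrite coefXM /= coef_deriv -mulr_natr; ring.
rewrite !horner_coef !mulr_sumr -big_split /=; apply: ler_sum => i _.
have c0 : 0 <= p`_i by have := p0 i; rewrite coef0.
rewrite expr1n mulr1.
have [Di|iD] := leqP D i.
  have : (D%:R : R) <= i%:R by rewrite ler_nat.
  have xi := exprn_ge0 i x0; have xD := exprn_ge0 D x0.
  have DD : 0 <= D%:R :> R by [].
  move=> H; have := ler_wpM2r (mulr_ge0 c0 xi) H.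
  have := mulr_ge0 (mulr_ge0 DD xD) c0; lra.
have xiD : x ^+ i <= x ^+ D by rewrite ler_weXn2l // ltnW.
have i0 : 0 <= p`_i * x ^+ i * i%:R by rewrite !mulr_ge0 // exprn_ge0.
have := ler_wpM2l (mulr_ge0 (ler0n R D) c0) xiD; lra.
Qed.

End CoefOrder.


(** Taking [D] beyond [x * Q + 1], the first two inequalities bound [H] by [x * Q] plus
    a multiple of [H1], hence of the square root of [H]. *)
Lemma growth_bound (R : realType) (x Q W : R) : 0 <= x -> 0 <= Q -> 0 <= W ->
  exists B : R, forall H H' H1 : R,
    (forall D, D%:R * H <= x * H' + D%:R * x ^+ D * H1) ->
    H' <= Q * (1 + H) -> H1 <= W * Num.sqrt H -> 0 <= H -> H <= B.
Proof.
move=> x0 Q0 W0; have xQ0 : 0 <= x * Q by rewrite mulr_ge0.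
have [D xQD] : exists D : nat, x * Q + 1 <= D%:R.
  by exists (Num.bound (x * Q + 1)); apply/ltW/archi_boundP; lra.
pose V := D%:R * x ^+ D * W.
have V0 : 0 <= V by rewrite !mulr_ge0 // exprn_ge0.
exists ((x * Q + V + 1) ^+ 2) => H H' H1 HD HQ HW H0.
have y0 := sqrtr_ge0 H; have yE := sqr_sqrtr H0; move: HW y0 yE.
set y := Num.sqrt H => HW y0 yE.
have VH : D%:R * x ^+ D * H1 <= V * y.
  by rewrite /V -(mulrA _ W) ler_wpM2l // mulr_ge0 // exprn_ge0.
have xH : x * H' <= x * Q + x * Q * H.
  by apply: le_trans (ler_wpM2l x0 HQ) _; rewrite mulrA mulrDr mulr1.
have HDQ : (x * Q + 1) * H <= D%:R * H by rewrite ler_wpM2r.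
have Hle : y ^+ 2 <= x * Q + V * y by have := HD D; rewrite yE; lra.
rewrite -yE ler_pXn2r ?nnegrE //; last by lra.
rewrite leNgt; apply/negP => yB.
have : (x * Q + V + 1) * y <= y * y by rewrite ler_wpM2r // ltW.
have : x * Q * 1 <= x * Q * y by rewrite ler_wpM2l //; lra.
move: Hle; rewrite expr2; lra.
Qed.

(** * The numbers game of a right-angled diagram *)

Section Game.
Variables (R : rcfType) (k : nat) (e : rel 'I_k).
Hypotheses (esym : symmetric e) (eirr : irreflexive e).
Local Notation P := {poly R}.
Implicit Types (w : seq 'I_k) (i j h : 'I_k).

(** Twice the Gram matrix of the deformed Tits form.  The offset [3] makes the
    coefficientwise growth factor [K = 2 + 'X] below at least [2]. *)
Definition cartan : 'M[P]_k :=
  \matrix_(i, j) if i == j then 2 else if e i j then - (3 + 'X) else 0.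

Definition reflection i : 'M[P]_k := 1%:M - delta_mx i i *m cartan.

Lemma cartanT : cartan^T = cartan.
Proof. by apply/matrixP => i j; rewrite !mxE eq_sym esym. Qed.

Lemma deltaCdelta i j :
  delta_mx i i *m cartan *m delta_mx j j = cartan i j *: delta_mx i j.
Proof.
apply/matrixP => a b; rewrite [LHS]mxE (bigD1 j) //= big1 ?addr0; last first.
  by move=> c cj; rewrite [delta_mx _ _ _ _]mxE (negbTE cj) /= mulr0.
rewrite mxE (bigD1 i) //= big1 ?addr0; last first.
  by move=> c cj; rewrite [delta_mx _ _ _ _]mxE (negbTE cj) andbF /= mul0r.
rewrite !mxE !eqxx !andbT /=.
by case: (a == i); case: (b == j); rewrite /= ?mulr1 ?mul1r ?mulr0 ?mul0r.
Qed.

Lemma reflectionK i : reflection i *m reflection i = 1%:M.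
Proof.
rewrite /reflection mulmxBl !mulmxBr !mul1mx !mulmx1 mulmxA deltaCdelta.
rewrite mxE eqxx -scalemxAl; set X := _ *m _.
by apply/matrixP => a b; rewrite !mxE; ring.
Qed.

(** As [reflection i] is an involution, this says that it preserves [cartan]. *)
Lemma tr_reflection_cartan i : (reflection i)^T *m cartan = cartan *m reflection i.
Proof.
rewrite /reflection linearB /= trmx1 trmx_mul cartanT trmx_delta.
by rewrite mulmxBl mulmxBr mul1mx mulmx1 mulmxA.
Qed.

Lemma reflection_comm i j : i != j -> ~~ e i j ->
  reflection i *m reflection j = reflection j *m reflection i.
Proof.
move=> ij eij; rewrite /reflection !mulmxBl !mulmxBr !mul1mx !mulmx1 !mulmxA.
have eji : ~~ e j i by rewrite esym.
have ji : j != i by rewrite eq_sym.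
rewrite !deltaCdelta !mxE (negbTE ij) (negbTE ji) (negbTE eij) (negbTE eji).
by rewrite !scale0r !mul0mx !subr0 -!addrA; congr (_ + _); rewrite addrC.
Qed.

(** State of the numbers game after firing the letters of [w], the head of [w] last.
    It lists the values on the simple roots of a linear form that starts from the
    constant one and moves under the reflections. *)
Fixpoint value w : 'rV[P]_k :=
  if w is j :: w' then value w' *m reflection j else const_mx 1.

(** The value that letter [i] had when it last fired, and [0] if it never did. *)
Fixpoint last_fired w i : P :=
  if w is j :: w' then if i == j then value w' 0 j else last_fired w' i else 0.

(** Firing a blocked letter would cancel its previous occurrence, since only
    commuting letters fired in between. *)
Fixpoint blocked w : pred 'I_k :=
  if w is j :: w' then fun i => (i == j) || (blocked w' i && ~~ e i j)
  else pred0.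

Fixpoint reduced w : bool :=
  if w is j :: w' then ~~ blocked w' j && reduced w' else true.

Fixpoint firing_vector w : 'rV[P]_k :=
  if w is j :: w' then firing_vector w' + value w' 0 j *: delta_mx 0 j else 0.

Lemma value_cons w j i : value (j :: w) 0 i = value w 0 i - value w 0 j * cartan j i.
Proof.
rewrite /= /reflection mulmxBr mulmx1 mulmxA 2!mxE; congr (_ - _).
rewrite mxE (bigD1 j) //= big1 ?addr0; last first.
  move=> c cj; rewrite mxE big1 ?mul0r // => d _.
  by rewrite mxE (negbTE cj) andbF mulr0.
congr (_ * _); rewrite mxE (bigD1 j) //= big1 ?addr0; last first.
  by move=> c cj; rewrite mxE (negbTE cj) mulr0.
by rewrite mxE !eqxx mulr1.
Qed.

(** Each firing subtracts a multiple of one row of [cartan]. *)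
Lemma value_firing_vector w : value w = const_mx 1 - firing_vector w *m cartan.
Proof.
elim: w => [|j w IHw]; first by rewrite /= mul0mx subr0.
apply/rowP => i; rewrite value_cons {1}IHw /= mulmxDl opprD addrA [RHS]mxE.
congr (_ + _); rewrite [RHS]mxE; congr (- _); rewrite [RHS]mxE.
rewrite (bigD1 j) //= big1 ?addr0; last first.
  by move=> c cj; rewrite !mxE (negbTE cj) !mulr0 mul0r.
by rewrite !mxE !eqxx mulr1.
Qed.

Definition weight w : P := \sum_i firing_vector w 0 i.

Lemma weight_cons j w : weight (j :: w) = weight w + value w 0 j.
Proof.
rewrite /weight /=; under eq_bigr => i _ do rewrite mxE.
rewrite big_split /=; congr (_ + _); rewrite (bigD1 j) //= big1 ?addr0.
  by rewrite !mxE !eqxx mulr1.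
by move=> c cj; rewrite !mxE (negbTE cj) mulr0.
Qed.

(** A neighbour of the letter that fires gains [K + 1] times the fired value; [K] of
    this is left after compensating for its own negative value. *)
Let K : P := 2 + 'X.

Lemma K_ge0 : 0 <=c K.
Proof. exact: coef_addr_ge0 (coef_nat_ge0 _ 2) (@coef_polyX_ge0 R). Qed.

Lemma ler_Kmul n p : (n <= 2)%N -> 0 <=c p -> n%:R * p <=c K * p.
Proof.
move=> n2 p0; apply/coef_subr_ge0; rewrite -mulrBl; apply: coef_mulr_ge0 => //.
rewrite /K addrAC -natrB //.
exact: coef_addr_ge0 (coef_nat_ge0 _ _) (@coef_polyX_ge0 R).
Qed.

Lemma cartan_e i j : e i j -> cartan i j = - (K + 1).
Proof.
by move=> eij; rewrite mxE eij; case: eqP eij => [->|_ _]; rewrite ?eirr /K //; ring.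
Qed.

Lemma value_cons_eq w j : value (j :: w) 0 j = - value w 0 j.
Proof. by rewrite value_cons mxE eqxx; ring. Qed.

Lemma value_cons_e w j i : e i j ->
  value (j :: w) 0 i = value w 0 i + (K * value w 0 j + value w 0 j).
Proof. by rewrite esym => /cartan_e eij; rewrite value_cons eij; ring. Qed.

Lemma value_cons_comm w j i : i != j -> ~~ e i j -> value (j :: w) 0 i = value w 0 i.
Proof.
by rewrite value_cons mxE eq_sym esym => /negbTE-> /negbTE->; rewrite mulr0 subr0.
Qed.

(** In a right-angled diagram a blocked letter carries the opposite of its last fired
    value, and becomes free, with a value [K] times larger than all last fired values
    around it, as soon as one neighbour fires.  The clauses record this growth in a form
    that one more firing preserves. *)
Record invariant w : Prop := Invariant {
  last_ge0 : forall i, 0 <=c last_fired w i;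
  blocked_value : forall i, blocked w i -> value w 0 i = - last_fired w i;
  blocked_last : forall i h, blocked w i -> e i h ->
    K * last_fired w h <=c last_fired w i;
  free_ge1 : forall i, ~~ blocked w i -> 1 <=c value w 0 i;
  free_self : forall i, ~~ blocked w i -> K * last_fired w i <=c value w 0 i;
  free_last : forall i h, ~~ blocked w i -> e i h ->
    K * last_fired w h <=c value w 0 i }.

Lemma reduced_invariant w : reduced w -> invariant w.
Proof.
elim: w => [_|j w IHw /= /andP[jfree /IHw inv]].
  split=> //= [i|i _|i _|i h _ _]; rewrite ?mulr0 ?mxE //; do ?exact: coef_le_refl.
  - exact: (@coef_nat_ge0 R 1).
  - exact: (@coef_nat_ge0 R 1).
have v1 := free_ge1 inv jfree.
have v0 : 0 <=c value w 0 j := coef_le_trans (@coef_nat_ge0 R 1) v1.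
have l0 := last_ge0 inv.
have Kv n : (n <= 2)%N -> n%:R * value w 0 j <=c K * value w 0 j.
  by move=> n2; exact: ler_Kmul.
have vKv : value w 0 j <=c K * value w 0 j.
  by rewrite -[X in X <=c _]mul1r; exact: (Kv 1%N).
have lKl h : last_fired w h <=c K * last_fired w h.
  by rewrite -[X in X <=c _]mul1r; exact: (ler_Kmul (n := 1)).
have newl h : last_fired (j :: w) h = if h == j then value w 0 j else last_fired w h.
  by [].
(* The [- last_fired w i] that a blocked neighbour carries is absorbed by one of the
   [K + 1] copies of the fired value. *)
have nbr i : e i j -> K * value w 0 j <=c value (j :: w) 0 i.
  move=> eij; rewrite value_cons_e //.
  have [bi|fi] := boolP (blocked w i).
    rewrite (blocked_value inv bi) addrC -addrA; apply: coef_lerDl.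
    apply/coef_subr_ge0; apply: coef_le_trans (lKl i) _.
    by apply: free_last; rewrite // esym.
  rewrite addrCA; apply: coef_lerDl; apply: coef_addr_ge0 => //.
  exact: coef_le_trans (@coef_nat_ge0 R 1) (free_ge1 inv fi).
have KvK h : K * last_fired w h <=c value w 0 j ->
    forall i, e i j -> K * last_fired w h <=c value (j :: w) 0 i.
  by move=> H i eij; apply: coef_le_trans H (coef_le_trans vKv (nbr i eij)).
have grow i : e i j -> value w 0 i <=c value (j :: w) 0 i.
  move=> eij; rewrite value_cons_e //.
  apply: coef_lerDl; apply: coef_addr_ge0 => //.
  exact: coef_le_trans v0 vKv.
split.
- by move=> i; rewrite newl; case: ifP.
- move=> i /= /orP[/eqP->|/andP[bi eij]]; first by rewrite value_cons_eq eqxx.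
  have ij : i != j by apply: contraNneq jfree => <-.
  by rewrite value_cons_comm // (negbTE ij) (blocked_value inv).
- move=> i h /= /orP[/eqP->|/andP[bi eij]].
    rewrite eqxx; case: eqP => [->|_ ejh]; first by rewrite eirr.
    exact: free_last.
  have ij : i != j by apply: contraNneq jfree => <-.
  rewrite (negbTE ij); case: eqP => [->|_]; first by rewrite (negbTE eij).
  exact: blocked_last.
- move=> i /=; rewrite negb_or negb_and negbK => /andP[ij].
  have [eij _|eij] := boolP (e i j).
    exact: coef_le_trans v1 (coef_le_trans vKv (nbr i eij)).
  by rewrite orbF value_cons_comm //; exact: free_ge1.
- move=> i /=; rewrite negb_or negb_and negbK => /andP[ij].
  rewrite (negbTE ij); have [eij _|eij] := boolP (e i j).
    by apply: KvK => //; apply: free_last; rewrite // esym.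
  by rewrite orbF value_cons_comm //; exact: free_self.
- move=> i h /=; rewrite negb_or negb_and negbK => /andP[ij].
  have [eij _|eij] := boolP (e i j); last first.
    rewrite orbF value_cons_comm // => fi eih.
    case: eqP => [hj|_]; first by rewrite -hj eih in eij.
    exact: free_last.
  case: eqP => [_ _|/eqP hj eih]; first exact: nbr.
  have [bi|fi] := boolP (blocked w i); last first.
    by apply: coef_le_trans (grow i eij); exact: free_last.
  apply: coef_le_trans (blocked_last inv bi eih) _.
  apply: coef_le_trans (lKl i) _; apply: KvK => //.
  by apply: free_last; rewrite // esym.
Qed.


Lemma sum_last_cons w j (Q : pred 'I_k) :
  \sum_(h | Q h) last_fired (j :: w) h =
  \sum_(h | Q h) last_fired w h
    + if Q j then value w 0 j - last_fired w j else 0.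
Proof.
rewrite [in RHS]big_mkcond [LHS]big_mkcond (bigD1 j) //= eqxx [in RHS](bigD1 j) //=.
rewrite addrAC; congr (_ + _); first by case: ifP => _; ring.
by apply: eq_bigr => h /negbTE->.
Qed.

(** Fired values at least double from one firing of a letter to the next, so the
    increase of [last_fired] controls the value just fired. *)
Lemma fired_gain w j : invariant w -> ~~ blocked w j ->
  value w 0 j <=c 2 * (value w 0 j - last_fired w j).
Proof.
move=> inv fj; apply/coef_subr_ge0.
have -> : 2 * (value w 0 j - last_fired w j) - value w 0 j =
          value w 0 j - 2%:R * last_fired w j by ring.
apply/coef_subr_ge0; apply: coef_le_trans (free_self inv fj).
exact: ler_Kmul (last_ge0 inv j).
Qed.

Lemma fired_ge0 w j : invariant w -> ~~ blocked w j -> 0 <=c value w 0 j.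
Proof.
by move=> inv fj; exact: coef_le_trans (@coef_nat_ge0 R 1) (free_ge1 inv fj).
Qed.

(** The increments of [value w 0 i] come from neighbours [h]; along the firings of
    each [h] they form a series dominated by a geometric one, hence by twice its
    last term. *)
Lemma value_le_last w i : reduced w ->
  value w 0 i <=c 1 + 2 * (K + 1) * \sum_(h | e i h) last_fired w h.
Proof.
have cK : 0 <=c K + 1 := coef_addr_ge0 K_ge0 (@coef_nat_ge0 R 1).
elim: w i => [i _|j w IHw i /= /andP[fj redw]].
  by rewrite big1 // mulr0 addr0 mxE; exact: coef_le_refl.
have inv := reduced_invariant redw.
have v0 := fired_ge0 inv fj.
rewrite -/(value (j :: w)) -/(last_fired (j :: w)) sum_last_cons.
have [->|ij] := eqVneq i j.
  rewrite value_cons_eq eirr addr0; apply: (@coef_le_trans _ 0).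
    by apply/coef_subr_ge0; rewrite opprK add0r.
  apply: coef_addr_ge0; first exact: (@coef_nat_ge0 R 1).
  apply: coef_mulr_ge0; first exact: coef_mulr_ge0 (@coef_nat_ge0 R 2) cK.
  by apply: coef_sum_ge0 => h _; exact: last_ge0.
have [eij|eij] := boolP (e i j); last by rewrite addr0 value_cons_comm //; exact: IHw.
rewrite value_cons_e // [X in _ <=c 1 + X]mulrDr [X in _ <=c X]addrA.
apply: coef_leD; first exact: IHw.
have -> : K * value w 0 j + value w 0 j = (K + 1) * value w 0 j by ring.
by rewrite mulrAC [X in _ <=c X]mulrC; apply: coef_ler_wpM2l => //; exact: fired_gain.
Qed.

Lemma firing_vector_ge0 w i : reduced w -> 0 <=c firing_vector w 0 i.
Proof.
elim: w => [|j w IHw] /=; first by rewrite mxE => _; exact: coef_le_refl.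
case/andP=> fj redw; rewrite !mxE; apply: coef_addr_ge0; first exact: IHw.
apply: coef_mulr_ge0; last exact: coef_nat_ge0.
exact: fired_ge0 (reduced_invariant redw) fj.
Qed.

Lemma weight_le_last w : reduced w -> weight w <=c 2 * \sum_i last_fired w i.
Proof.
elim: w => [_|j w IHw /= /andP[fj redw]].
  by rewrite /weight !big1 => *; rewrite ?mulr0 ?mxE //; exact: coef_le_refl.
rewrite weight_cons -/(last_fired (j :: w)) sum_last_cons mulrDr.
by apply: coef_leD; [exact: IHw | exact: fired_gain (reduced_invariant redw) fj].
Qed.

Lemma last_le_weight w i : reduced w -> last_fired w i <=c weight w.
Proof.
elim: w => [_|j w IHw /= /andP[fj redw]].
  by rewrite /weight big1 => *; rewrite ?mxE //; exact: coef_le_refl.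
have v0 := fired_ge0 (reduced_invariant redw) fj.
rewrite weight_cons; case: ifP => _.
  rewrite addrC; apply: coef_lerDl.
  by apply: coef_sum_ge0 => h _; exact: firing_vector_ge0.
exact: coef_le_trans (IHw redw) (coef_lerDl _ v0).
Qed.

Lemma size_le_weight w : reduced w -> (size w)%:R <=c weight w.
Proof.
elim: w => [_|j w IHw /= /andP[fj redw]].
  by rewrite /weight big1 => *; rewrite ?mxE //; exact: coef_le_refl.
rewrite weight_cons -natr1; apply: coef_leD; first exact: IHw.
exact (free_ge1 (reduced_invariant redw) fj).
Qed.

(** Growth superlinear in the parameter. A value fired by [j] is, at [X = 1], at
    most [1 + 8 S] where [S] sums the last fired values of at most [k] neighbours,
    while at [x] it is at least [x + 2] times each of them. With [x + 2] beyond [(16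
    * k) ^ 2] the square root of this factor outweighs the constants, and the bound
    propagates. *)
Lemma last_fired_sqrt w (x : R) i : reduced w -> 0 <= x -> (16 * k)%:R ^+ 2 <= x + 2 ->
  (last_fired w i).[1] <= 2 * Num.sqrt (last_fired w i).[x].
Proof.
move=> redw x0 xk.
elim: w redw i => [_ i|j w IHw /= /andP[fj redw] i].
  by rewrite !horner0 sqrtr0 mulr0.
case: ifP => _; last exact: IHw.
have inv := reduced_invariant redw.
set b := (value w 0 j).[x].
have b1 : 1 <= Num.sqrt b.
  rewrite -sqrtr1 ler_wsqrtr //; have := coef_le_horner x0 (free_ge1 inv fj).
  by rewrite hornerC.
have l0 h y : 0 <= y -> 0 <= (last_fired w h).[y].
  by move=> y0; have := coef_le_horner y0 (last_ge0 inv h); rewrite horner0.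
have Hl h : e j h -> (16 * k)%:R * Num.sqrt (last_fired w h).[x] <= Num.sqrt b.
  move=> ejh; rewrite -[X in X * _]ger0_norm // -sqrtr_sqr -sqrtrM ?sqr_ge0 //.
  rewrite ler_wsqrtr //; have := coef_le_horner x0 (free_last inv fj ejh).
  rewrite /K !hornerE => H; apply: le_trans H.
  by rewrite ler_wpM2r // ?l0 // addrC.
have k0 : (0 : R) < k%:R by rewrite ltr0n; case: (k) (j) => // -[].
have := coef_le_horner ler01 (value_le_last j redw).
rewrite /K !hornerE horner_sum => H; apply: le_trans H _.
suff : k%:R * \sum_(h | e j h) (8 * (last_fired w h).[1]) <= k%:R * Num.sqrt b.
  rewrite ler_pM2l // -mulr_sumr => H; lra.
have -> : k%:R * Num.sqrt b = \sum_(h < k) Num.sqrt b.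
  by rewrite sumr_const card_ord -[RHS]mulr_natl.
rewrite mulr_sumr big_mkcond; apply: ler_sum => h _; case: ifP => ejh; last lra.
apply: le_trans (Hl h ejh); rewrite natrM.
have := IHw redw h => H; have := ler_wpM2l (ltW k0) H; lra.
Qed.

Lemma weight_sqrt w (x : R) : reduced w -> 0 <= x -> (16 * k)%:R ^+ 2 <= x + 2 ->
  (weight w).[1] <= (4 * k)%:R * Num.sqrt (weight w).[x].
Proof.
move=> redw x0 xk.
apply: le_trans (coef_le_horner ler01 (weight_le_last redw)) _.
rewrite !hornerE horner_sum.
have -> : (4 * k)%:R * Num.sqrt (weight w).[x] =
          2 * \sum_(h < k) (2 * Num.sqrt (weight w).[x]).
  by rewrite sumr_const card_ord -[in RHS]mulr_natl natrM; ring.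
rewrite ler_wpM2l  ?addr_ge0 //; apply: ler_sum => h _.
apply: le_trans (last_fired_sqrt h redw x0 xk) _.
by rewrite ler_wpM2l // ler_wsqrtr // coef_le_horner //; exact: last_le_weight.
Qed.

End Game.

(** * Reduced words and the reflection representation *)

Section Presentation.
Variables (R : rcfType) (k : nat) (G : groupType).
Variables (m : 'I_k -> 'I_k -> option nat) (gen : 'I_k -> G).
Hypotheses (ram : right_angled m) (pres : has_presentation gen (coxeter_rels m)).
Implicit Types (g h : G) (i j : 'I_k).

Definition noncommuting : rel 'I_k := fun i j => m i j == None.
Local Notation e := noncommuting.
Local Notation P := {poly R}.

Lemma noncommuting_sym : symmetric e.
Proof. by case: ram => _ msym _ i j; rewrite /e msym. Qed.

Lemma noncommuting_irr : irreflexive e.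
Proof. by case: ram => m1 _ _ i; rewrite /e m1. Qed.

Lemma coxeter_rel_eval i j n : m i j = Some n -> ((gen i * gen j) ^+ n = 1)%g.
Proof.
move=> mij; have /(pres.2 _) : pres_eq (coxeter_rels m)
    (flatten (nseq n [:: (i, true); (j, true)])) [::].
  rewrite -[flatten _]cats0 -[X in pres_eq _ X]cat0s; apply: (@pres_rel _ _ [::] [::]).
  by exists i, j, n.
rewrite /eval_fword => <-; elim: n {mij} => [|n IHn] /=; first by rewrite big_nil.
by rewrite expgS 2!big_cons /= -IHn mulgA.
Qed.

Lemma gen_involution i : (gen i * gen i = 1)%g.
Proof. by case: ram => m1 _ _; exact: coxeter_rel_eval (m1 i). Qed.

Lemma genV i : ((gen i)^-1 = gen i)%g.
Proof. by apply: (mulgI (gen i)); rewrite mulgV gen_involution. Qed.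

Lemma gen_commute i j : i != j -> ~~ e i j -> (gen i * gen j = gen j * gen i)%g.
Proof.
case: ram => _ _ m2 /m2[mij|mij]; last by rewrite /e mij.
have := coxeter_rel_eval mij; rewrite expg2 => H _.
apply: (mulIg (gen i * gen j)%g).
by rewrite H -mulgA (mulgA (gen i)) gen_involution mul1g gen_involution.
Qed.

(** A blocked letter can be moved to the front of the word through the commuting
    letters that fired after it. *)
Lemma blocked_unfire w i : blocked e w i ->
  exists2 w', (size w' < size w)%N &
    (\prod_(j <- w) gen j = gen i * \prod_(j <- w') gen j)%g.
Proof.
elim: w => //= j w IHw /orP[/eqP->|/andP[/IHw[w' w'w Ew] eij]].
  by exists w; rewrite ?big_cons.
have [->|ij] := eqVneq i j; first by exists w; rewrite ?big_cons.
by exists (j :: w'); rewrite //= !big_cons Ew !mulgA (gen_commute ij eij).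
Qed.

(** A blocked letter cancels with its previous occurrence, which shortens the word, so
    the process stops at a reduced word. *)
Lemma reduced_word_shorter w :
  exists2 w', reduced e w' & (size w' <= size w)%N /\
    (\prod_(j <- w') gen j = \prod_(j <- w) gen j)%g.
Proof.
have [n] := ubnP (size w); elim: n w => // n IHn [|j w] /=; first by exists [::].
rewrite ltnS => wn; have [w1 red1 [sw1 Ew1]] := IHn w wn.
have [bj|fj] := boolP (blocked e w1 j); last first.
  by exists (j :: w1); rewrite /= ?fj ?red1 ?ltnS ?sw1 ?big_cons ?Ew1.
have [w2 sw2 Ew2] := blocked_unfire bj.
have w2w : (size w2 < size w)%N by exact: leq_trans sw2 sw1.
have [w3 red3 [sw3 Ew3]] := IHn w2 (ltn_trans w2w wn).
exists w3 => //; split; first by rewrite (leq_trans sw3) // ltnW // ltnS ltnW.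
by rewrite big_cons -Ew1 Ew2 mulgA gen_involution mul1g.
Qed.

Lemma reduced_word g :
  exists2 w, reduced e w & g = (\prod_(j <- w) gen j)%g.
Proof.
have [u <-] := pres.1 g.
have [w redw [_ Ew]] := reduced_word_shorter [seq x.1 | x <- u].
exists w => //; rewrite Ew big_map /eval_fword.
by apply: eq_bigr => -[j []] _ //=; rewrite genV.
Qed.

(** Sending a letter of either sign to its reflection respects the free cancellations
    and the Coxeter relations, so the product along a word depends only on the group
    element; the representation evaluates it on a chosen word. *)
Lemma reflection_representation : exists rho : G -> 'M[P]_k,
  [/\ forall g h, rho (g * h)%g = rho g *m rho h, rho 1%g = 1%:M
    & forall i, rho (gen i) = reflection R e i].
Proof.
pose ev (u : fword 'I_k) : 'M[P]_k := \big[mulmx/1%:M]_(x <- u) reflection R e x.1.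
have ev_cat u v : ev (u ++ v) = ev u *m ev v.
  elim: u => [|x u IHu]; first by rewrite /ev big_nil mul1mx.
  by rewrite /ev /= !big_cons -mulmxA -/(ev _) IHu.
have evC u v : pres_eq (coxeter_rels m) u v -> ev u = ev v.
  elim=> // {u v} [u v w _ -> _ ->//|u v i b|u v r [i [j [n [mij ->]]]]].
    by rewrite !ev_cat /ev !big_cons big_nil /= mulmx1 reflectionK mul1mx.
  rewrite !ev_cat; suff -> : ev (flatten (nseq n [:: (i, true); (j, true)])) = 1%:M.
    by rewrite mul1mx.
  case: ram => m1 _ m2; have [ij|ij] := eqVneq i j.
    subst j; move: mij; rewrite m1 => -[<-] /=.
    by rewrite /ev !big_cons big_nil /= mulmx1 reflectionK.
  case: (m2 _ _ ij) => mij'; move: (mij); rewrite mij' // => -[<-] /=.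
  have eij : ~~ e i j by rewrite /e mij'.
  rewrite /ev !big_cons big_nil /= mulmx1 !mulmxA.
  rewrite (reflection_comm _ noncommuting_sym ij eij).
  by rewrite -(mulmxA (reflection R e j)) reflectionK mulmx1 reflectionK.
have ev_rev u : ev (rev u) *m ev u = 1%:M.
  elim: u => [|x u IHu]; first by rewrite /ev !big_nil mul1mx.
  rewrite rev_cons -cats1 ev_cat -[x :: u]cat1s ev_cat mulmxA -(mulmxA (ev (rev u))).
  by rewrite -ev_cat /= {2}/ev !big_cons big_nil mulmx1 reflectionK mulmx1.
have eval_cat u v : (eval_fword gen (u ++ v) = eval_fword gen u * eval_fword gen v)%g.
  exact: big_cat.
have eval_rev u : (eval_fword gen (rev u) = (eval_fword gen u)^-1)%g.
  rewrite /eval_fword -{2}(revK u) -prodgV; apply: eq_bigr => -[i b] _ /=.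
  by case: b; rewrite ?invgK genV.
have evE u v : eval_fword gen u = eval_fword gen v -> ev u = ev v.
  move=> uv; have : ev (u ++ rev v) = ev [::].
    by apply/evC/pres.2; rewrite eval_cat eval_rev uv mulgV.
  rewrite ev_cat {3}/ev big_nil => H.
  by rewrite -[LHS]mulmx1 -(ev_rev v) mulmxA H mul1mx.
pose word g := sval (cid (pres.1 g)).
have wordK g : eval_fword gen (word g) = g by rewrite /word; case: cid.
exists (ev \o word); split=> /= [g h||i].
- by rewrite -ev_cat; apply: evE; rewrite eval_cat !wordK.
- rewrite (evE _ [::]); first by rewrite /ev big_nil.
  by rewrite wordK /eval_fword big_nil.
- rewrite (evE _ [:: (i, true)]); first by rewrite /ev big_cons big_nil mulmx1.
  by rewrite wordK /eval_fword big_cons big_nil /= mulg1.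
Qed.

End Presentation.

(** * Affine actions from first-order deformations *)

Section SkewCoordinates.
Variables (R : realFieldType) (k : nat).
Local Notation N := ((k * (k - 1)) %/ 2)%N.

Definition lower_pairs : {set 'I_k * 'I_k} :=
  [set p : 'I_k * 'I_k | (p.2 < p.1)%N].

Lemma card_lower_pairs : #|lower_pairs| = N.
Proof.
rewrite -sum1dep_card.
rewrite -(pair_big_dep xpredT (fun i j : 'I_k => (j < i)%N) (fun _ _ => 1%N)) /=.
transitivity (\sum_(i < k) (i : nat))%N.
  apply: eq_bigr => i _; rewrite -(big_ord_widen k (fun=> 1%N)); last exact: ltnW.
  by rewrite sum1_card card_ord.
by rewrite -(big_mkord xpredT id) bin2_sum bin2 subn1 divn2.
Qed.

Definition lower_pair (n : 'I_N) : 'I_k * 'I_k :=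
  enum_val (cast_ord (esym card_lower_pairs) n).

Lemma lower_pair_lt n : ((lower_pair n).2 < (lower_pair n).1)%N.
Proof. by have := enum_valP (cast_ord (esym card_lower_pairs) n); rewrite inE. Qed.

Lemma lower_pair_inj : injective lower_pair.
Proof. by move=> n n' /enum_val_inj /cast_ord_inj. Qed.

Lemma lower_pair_surj (i j : 'I_k) : (j < i)%N -> exists n, lower_pair n = (i, j).
Proof.
move=> ji; have ijU : (i, j) \in lower_pairs by rewrite inE.
exists (cast_ord card_lower_pairs (enum_rank_in ijU (i, j))).
by rewrite /lower_pair cast_ordK enum_rankK_in.
Qed.

Definition skew (x : 'cV[R]_N) : 'M[R]_k :=
  \matrix_(i, j) \sum_n
    x n 0 * ((lower_pair n == (i, j))%:R - (lower_pair n == (j, i))%:R).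

Definition lower_entries (S : 'M[R]_k) : 'cV[R]_N :=
  \col_n S (lower_pair n).1 (lower_pair n).2.

Fact skew_is_linear : linear skew.
Proof.
move=> a u v; apply/matrixP => i j; rewrite !mxE mulr_sumr -big_split /=.
by apply: eq_bigr => n _; rewrite !mxE mulrDl mulrA.
Qed.
HB.instance Definition _ := GRing.isLinear.Build R _ _ _ skew skew_is_linear.

Fact lower_entries_is_linear : linear lower_entries.
Proof. by move=> a u v; apply/matrixP => i j; rewrite !mxE. Qed.
HB.instance Definition _ :=
  GRing.isLinear.Build R _ _ _ lower_entries lower_entries_is_linear.

Lemma skewT x : (skew x)^T = - skew x.
Proof.
apply/matrixP => i j; rewrite !mxE -sumrN; apply: eq_bigr => n _; ring.
Qed.

Lemma skew_lower x n : skew x (lower_pair n).1 (lower_pair n).2 = x n 0.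
Proof.
rewrite mxE (bigD1 n) //= big1 ?addr0 => [|n' n'n].
  rewrite -surjective_pairing eqxx; case: eqP => [E|_]; last by rewrite subr0 mulr1.
  by have := lower_pair_lt n; rewrite {1 2}E ltnNge ltnW // lower_pair_lt.
rewrite -surjective_pairing (inj_eq lower_pair_inj) (negbTE n'n).
case: eqP => [E|_]; last by rewrite subr0 mulr0.
have := lower_pair_lt n'; rewrite E /= => H.
by have := lower_pair_lt n; rewrite ltnNge ltnW.
Qed.

Lemma skewK : cancel skew lower_entries.
Proof. by move=> x; apply/colP => n; rewrite mxE skew_lower. Qed.

Lemma lower_entriesK S : S^T = - S -> skew (lower_entries S) = S.
Proof.
move=> ST; have Sji i j : S j i = - S i j by have /matrixP/(_ i j) := ST; rewrite !mxE.
have lowS (i j : 'I_k) : (j < i)%N -> skew (lower_entries S) i j = S i j.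
  case/lower_pair_surj=> n E; have := skew_lower (lower_entries S) n.
  by rewrite [in X in _ = X -> _]mxE E.
have skewji i j : skew (lower_entries S) j i = - skew (lower_entries S) i j.
  by have /matrixP/(_ i j) := skewT (lower_entries S); rewrite !mxE.
apply/matrixP => i j; case: (ltngtP i j) => [ij|ji|/ord_inj ->].
- by rewrite skewji lowS // Sji opprK.
- exact: lowS.
- have := skewji j j; have := Sji j j; lra.
Qed.

Lemma skew_bound (x : 'cV[R]_N) (b : R) i j :
  (forall n, `|x n 0| <= b) -> `|skew x i j| <= N%:R * b.
Proof.
move=> xb; rewrite mxE; apply: le_trans (ler_norm_sum _ _ _) _.
have -> : N%:R * b = \sum_(n < N) b by rewrite sumr_const card_ord mulr_natl.
apply: ler_sum => n _; rewrite normrM; apply: le_trans (xb n).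
rewrite ler_piMr //; case: eqP; case: eqP => _ _;
  by rewrite ?subrr ?subr0 ?sub0r ?normrN ?normr0 ?normr1.
Qed.

End SkewCoordinates.

Lemma linear_col_mx (R : comNzRingType) (n : nat) (L : {linear 'cV[R]_n -> 'cV[R]_n}) :
  exists P : 'M[R]_n, forall x, L x = P *m x.
Proof.
exists (\matrix_(i, j) L (delta_mx j 0) i 0) => x; apply/colP => i.
rewrite {1}(matrix_sum_delta x) linear_sum summxE mxE; apply: eq_bigr => j _.
by rewrite big_ord_recl big_ord0 addr0 linearZ !mxE mulrC.
Qed.

(** [r] and [d] stand for a representation and its derivative at a parameter, [A]
    and [A'] for the invariant form and its derivative; [dM] and [dA] are the
    Leibniz rule applied to [rM] and [rA]. *)
Section AffineAction.
Variables (R : realType) (k : nat) (G : groupType).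
Variables (A A' : 'M[R]_k) (r d : G -> 'M[R]_k).
Hypotheses (AT : A^T = A) (AT' : A'^T = A').
Hypotheses (rM : forall g h, r (g * h)%g = r g *m r h) (r1 : r 1%g = 1%:M).
Hypothesis dM : forall g h, d (g * h)%g = d g *m r h + r g *m d h.
Hypothesis rA : forall g, (r g)^T *m A *m r g = A.
Hypothesis dA : forall g,
  (d g)^T *m A *m r g + (r g)^T *m A' *m r g + (r g)^T *m A *m d g = A'.
Local Notation N := ((k * (k - 1)) %/ 2)%N.

(** The forms [M] with [M + M^T = - A'] are parametrized by skew matrices, shifted
    by the symmetric solution [- A' / 2]. *)
Definition tangent_form (x : 'cV[R]_N) : 'M[R]_k := skew x - 2^-1 *: A'.

(** Deforming [r] together with the identity moves an infinitesimal endomorphism [X]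
    to [r g *m X *m r g^-1 + d g *m r g^-1]; this is the same rule for the form
    [M = A *m X]. *)
Definition form_act g (M : 'M[R]_k) : 'M[R]_k :=
  (r g^-1)^T *m M *m r g^-1 + A *m d g *m r g^-1.

Definition tangent_action g x : 'cV[R]_N :=
  lower_entries (form_act g (tangent_form x) + 2^-1 *: A').

Lemma r_mulV g : r g *m r g^-1 = 1%:M.
Proof. by rewrite -rM mulgV r1. Qed.

Lemma r_Vmul g : r g^-1 *m r g = 1%:M.
Proof. by rewrite -rM mulVg r1. Qed.

Lemma contragredient g : (r g^-1)^T *m A = A *m r g.
Proof. by rewrite -[in LHS](rA g) !mulmxA -trmx_mul r_mulV trmx1 mul1mx. Qed.

Lemma form_actM g h M : form_act (g * h)%g M = form_act g (form_act h M).
Proof.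
rewrite /form_act invgM dM !rM trmx_mul !(mulmxDr, mulmxDl) !mulmxA.
rewrite contragredient -!mulmxA addrA addrAC; congr (_ + _ + _).
by rewrite !mulmxA -(mulmxA _ (r h)) r_mulV mulmx1.
Qed.

Lemma form_act_mulr g M : form_act g M *m r g = (r g^-1)^T *m M + A *m d g.
Proof. by rewrite mulmxDl -!mulmxA r_Vmul !mulmx1. Qed.

Lemma form_act1 M : form_act 1%g M = M.
Proof.
have d1 : d 1%g = 0.
  have := dM 1%g 1%g; rewrite mulg1 r1 mulmx1 mul1mx => /eqP.
  by rewrite -subr_eq0 opprD addrA subrr add0r oppr_eq0 => /eqP.
by rewrite /form_act invg1 r1 d1 mulmx0 mul0mx addr0 trmx1 mulmx1 mul1mx.
Qed.

(** Conjugating the differentiated invariance [dA] by [r g^-1] shows that the cocycle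
    compensates exactly the change of [A'] under [g]. *)
Lemma form_act_trmx g M : M + M^T = - A' ->
  form_act g M + (form_act g M)^T = - A'.
Proof.
move=> MA; rewrite /form_act linearD /= !trmx_mul trmxK AT addrACA.
have <- : (r g^-1)^T *m (M + M^T) *m r g^-1 =
    (r g^-1)^T *m M *m r g^-1 + (r g^-1)^T *m (M^T *m r g^-1).
  by rewrite mulmxDr mulmxDl !mulmxA.
rewrite MA mulmxN mulNmx; set W := A *m _ *m _ + _.
have -> : (r g^-1)^T *m A' *m r g^-1 = W + A'.
  have := congr1 (fun B => (r g^-1)^T *m B *m r g^-1) (dA g).
  rewrite !(mulmxDr, mulmxDl) !mulmxA -!trmx_mul -!(mulmxA _ (r g)) !r_mulV !mulmx1.
  rewrite trmx1 !mul1mx => <-; rewrite trmx_mul /W mulmxA addrAC.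
  by congr (_ + _); exact: addrC.
by rewrite opprD addrAC addNr add0r.
Qed.

Lemma form_trmx x : tangent_form x + (tangent_form x)^T = - A'.
Proof.
apply/matrixP => i j.
have /matrixP/(_ i j) := AT'; have /matrixP/(_ i j) := skewT x.
rewrite /tangent_form; set S := skew x; rewrite !mxE; lra.
Qed.

Lemma form_tangent_action g x :
  tangent_form (tangent_action g x) = form_act g (tangent_form x).
Proof.
rewrite /tangent_form /tangent_action lower_entriesK ?addrK //.
have := form_act_trmx g (form_trmx x); set M := form_act _ _ => MT.
apply/matrixP => i j.
have /matrixP/(_ i j) := AT'; have /matrixP/(_ i j) := MT.
rewrite !mxE; lra.
Qed.

Lemma lower_entries_form x : lower_entries (tangent_form x + 2^-1 *: A') = x.
Proof. by rewrite /tangent_form subrK skewK. Qed.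

Lemma tangent_actionM g h x :
  tangent_action (g * h)%g x = tangent_action g (tangent_action h x).
Proof. by rewrite {1 2}/tangent_action form_tangent_action form_actM. Qed.

Lemma tangent_action1 x : tangent_action 1%g x = x.
Proof. by rewrite /tangent_action form_act1 lower_entries_form. Qed.

Lemma tangent_action_affine g :
  exists (P : 'M[R]_N) b, forall x, tangent_action g x = P *m x + b.
Proof.
pose L := @lower_entries R k \o (mulmxr (r g^-1) \o (mulmx (r g^-1)^T \o @skew R k)).
have [P LP] := linear_col_mx L; exists P, (tangent_action g 0) => x.
rewrite -LP /L /= /tangent_action /form_act /tangent_form !linear0 sub0r.
rewrite !(mulmxBr, mulmxBl) mulmxN mulNmx -linearD /=; congr (@lower_entries R k _).
by rewrite !addrA.
Qed.

Lemma tangent_action_affine_action : affine_action tangent_action.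
Proof.
split=> [g|g h]; last by apply/funext => x; exact: tangent_actionM.
have [P [b Pb]] := tangent_action_affine g.
have [Q [c Qc]] := tangent_action_affine g^-1%g.
exists P, b; split=> //.
have PQ x : P *m (Q *m x + c) + b = x.
  by rewrite -Qc -Pb -tangent_actionM mulgV tangent_action1.
have bc : P *m c + b = 0 by have := PQ 0; rewrite mulmx0 add0r.
suff /mulmx1_unit[] : P *m Q = 1%:M by [].
apply/matrixP => i j; have := PQ (delta_mx j 0).
rewrite mulmxDr -addrA bc addr0 mulmxA => /colP/(_ i).
by rewrite -colE !mxE eqxx andbT.
Qed.

End AffineAction.

(** * The derivative identity and its estimate *)

Section PolynomialMatrices.
Variables (R : realFieldType) (x : R).

Definition deriv_at m n (M : 'M[{poly R}]_(m, n)) : 'M[R]_(m, n) :=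
  map_mx (fun p => p^`().[x]) M.

Local Notation ev := (map_mx (horner_eval x)).

Lemma deriv_at_mulmx m n l (M : 'M[{poly R}]_(m, n)) (N : 'M[{poly R}]_(n, l)) :
  deriv_at (M *m N) = deriv_at M *m ev N + ev M *m deriv_at N.
Proof.
apply/matrixP => i j; rewrite !mxE raddf_sum horner_sum -big_split /=.
by apply: eq_bigr => h _; rewrite !mxE derivM !hornerE.
Qed.

Lemma deriv_at_sub m n (M N : 'M[{poly R}]_(m, n)) :
  deriv_at (M - N) = deriv_at M - deriv_at N.
Proof. by apply/matrixP => i j; rewrite !mxE derivB !hornerE. Qed.

End PolynomialMatrices.

Section BilinearBound.
Variable R : realFieldType.

Definition norm1 m n (M : 'M[R]_(m, n)) : R := \sum_i \sum_j `|M i j|.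

Lemma norm1_ge0 m n (M : 'M[R]_(m, n)) : 0 <= norm1 M.
Proof. by apply: sumr_ge0 => i _; apply: sumr_ge0. Qed.

Lemma entry_le_norm1 m n (M : 'M[R]_(m, n)) i j : `|M i j| <= norm1 M.
Proof.
rewrite /norm1 (bigD1 i) //= (bigD1 j) //= -addrA lerDl.
by apply: addr_ge0; apply: sumr_ge0 => *; rewrite ?sumr_ge0.
Qed.

Lemma norm1D m n (M N : 'M[R]_(m, n)) : norm1 (M + N) <= norm1 M + norm1 N.
Proof.
rewrite -big_split; apply: ler_sum => i _; rewrite -big_split; apply: ler_sum => j _.
by rewrite mxE ler_normD.
Qed.

Lemma norm1_trmx m n (M : 'M[R]_(m, n)) : norm1 M^T = norm1 M.
Proof.
rewrite /norm1 exchange_big; apply: eq_bigr => i _; apply: eq_bigr => j _.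
by rewrite mxE.
Qed.

Lemma bilinear_bound k (u : 'rV[R]_k) (M : 'M[R]_k) (v : 'cV[R]_k) c :
  (forall i j, `|M i j| <= c) ->
  `|(u *m M *m v) 0 0| <= c * norm1 u * norm1 v.
Proof.
move=> Mc; rewrite mxE /norm1 mulr_sumr; apply: le_trans (ler_norm_sum _ _ _) _.
apply: ler_sum => j _; rewrite !big_ord_recl !big_ord0 !addr0 normrM.
rewrite ler_wpM2r // mxE mulr_sumr; apply: le_trans (ler_norm_sum _ _ _) _.
by apply: ler_sum => i _; rewrite normrM mulrC ler_wpM2r.
Qed.

End BilinearBound.

Section TangentIdentity.
Variables (R : realType) (k : nat) (G : groupType).
Variables (A A' : 'M[R]_k) (r d : G -> 'M[R]_k).
Hypotheses (AT : A^T = A) (Aunit : A \in unitmx).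
Hypotheses (rM : forall g h, r (g * h)%g = r g *m r h) (r1 : r 1%g = 1%:M).
Hypothesis rA : forall g, (r g)^T *m A *m r g = A.
Local Notation one := (const_mx 1 : 'rV[R]_k).

Variable v : 'cV[R]_k.
Hypothesis mul_base_point : A *m v = - one^T.

Lemma base_point_mul : v^T *m A = - one.
Proof. by rewrite -[in LHS]AT -trmx_mul mul_base_point linearN /= trmxK. Qed.

(** Invariance of [A] identifies [r g^-1] with the adjoint of [r g], so the row
    equation for [g] describes the orbit of [v] under the inverse. *)
Lemma orbit_base_point g n : one *m r g = one - n *m A -> r g^-1%g *m v = v + n^T.
Proof.
move=> rn; apply: (can_inj (mulKmx Aunit)).
rewrite mulmxDr mulmxA -(contragredient rM r1 rA) invgK -mulmxA mul_base_point.
by rewrite mulmxN -trmx_mul rn linearB /= opprB trmx_mul AT [LHS]addrC.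
Qed.

(** Both sums equal [one *m r g *m v - one *m v], computed by moving [r g] to the
    right or to the left. *)
Lemma sum_firing_inv g n nV :
  one *m r g = one - n *m A -> one *m r g^-1%g = one - nV *m A ->
  \sum_i nV 0 i = \sum_i n 0 i.
Proof.
move=> rn rnV; have := orbit_base_point rnV; rewrite invgK => Eg.
have := congr1 (mulmx^~ v) rn; rewrite /= -mulmxA Eg mulmxDr mulmxBl.
rewrite -(mulmxA n) mul_base_point mulmxN opprK => /addrI /matrixP/(_ 0 0).
rewrite !mxE => H; rewrite -[RHS](_ : \sum_j n 0 j * (one^T) j 0 = _); last first.
  by apply: eq_bigr => i _; rewrite !mxE mulr1.
by rewrite -H; apply: eq_bigr => i _; rewrite !mxE mul1r.
Qed.

(** The relation [N *m r g = (r g^-1)^T *m M + A *m d g] evaluated on [(v, v)]: the term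
    [v^T *m A *m d g *m v] produces the sum of [n'], because [v^T *m A = - one] and
    [A *m v = - one^T]. *)
Lemma tangent_identity g n n' nV M N :
  one *m r g = one - n *m A -> one *m r g^-1%g = one - nV *m A ->
  one *m d g = - (n' *m A + n *m A') ->
  N *m r g = (r g^-1%g)^T *m M + A *m d g ->
  \sum_i n' 0 i = (n *m A' *m v) 0 0 + ((v^T + n) *m M *m v) 0 0
                  - (v^T *m N *m (v + nV^T)) 0 0.
Proof.
move=> rn rnV dn /(congr1 (fun B => v^T *m B *m v)).
have := orbit_base_point rnV; rewrite invgK => <-.
have -> : v^T + n = (r g^-1%g *m v)^T by rewrite (orbit_base_point rn) linearD /= trmxK.
rewrite mulmxDr mulmxDl !mulmxA base_point_mul mulNmx dn opprK mulmxDl.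
rewrite -(mulmxA n') mul_base_point mulmxN trmx_mul => ->.
have -> : \sum_i n' 0 i = (n' *m one^T) 0 0.
  by rewrite mxE; apply: eq_bigr => i _; rewrite !mxE mulr1.
rewrite !mxE; ring.
Qed.

Lemma norm1_nneg (n : 'rV[R]_k) : (forall i, 0 <= n 0 i) -> norm1 n = \sum_i n 0 i.
Proof.
move=> n0; rewrite /norm1 big_ord_recl big_ord0 addr0.
by apply: eq_bigr => i _; rewrite ger0_norm.
Qed.

(** Each term of [tangent_identity] is bilinear in [v], [n] and [nV] with bounded
    coefficients, and the nonnegative rows [n] and [nV] have equal sums. *)
Lemma tangent_bound (c : R) : exists2 Q : R, 0 <= Q & forall g n n' nV M N,
  one *m r g = one - n *m A -> one *m r g^-1%g = one - nV *m A ->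
  one *m d g = - (n' *m A + n *m A') ->
  N *m r g = (r g^-1%g)^T *m M + A *m d g ->
  (forall i, 0 <= n 0 i) -> (forall i, 0 <= nV 0 i) ->
  (forall i j, `|M i j| <= c) -> (forall i j, `|N i j| <= c) ->
  \sum_i n' 0 i <= Q * (1 + \sum_i n 0 i).
Proof.
pose a := norm1 A'; pose V := norm1 v; pose C := Num.max c 0.
have a0 : 0 <= a := norm1_ge0 _; have V0 : 0 <= V := norm1_ge0 _.
have C0 : 0 <= C by rewrite le_max lexx orbT.
have AA' i j : `|A' i j| <= a := entry_le_norm1 _ _ _.
exists (a * V + 2 * (C * (V + 1) * V)).
  by rewrite addr_ge0 ?mulr_ge0 // addr_ge0.
move=> g n n' nV M N rn rnV dn MN n0 nV0 Mc Nc.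
have MC i j : `|M i j| <= C by rewrite le_max Mc.
have NC i j : `|N i j| <= C by rewrite le_max Nc.
rewrite (tangent_identity rn rnV dn MN).
set H := \sum_i n 0 i.
have H0 : 0 <= H by apply: sumr_ge0.
have B1 := bilinear_bound n v AA'.
have B2 := bilinear_bound (v^T + n) v MC.
have B3 := bilinear_bound v^T (v + nV^T) NC.
have N2 : norm1 (v^T + n) <= V + H.
  by apply: le_trans (norm1D _ _) _; rewrite norm1_trmx (norm1_nneg n0).
have N3 : norm1 (v + nV^T) <= V + H.
  apply: le_trans (norm1D _ _) _.
  by rewrite norm1_trmx (norm1_nneg nV0) (sum_firing_inv rn rnV).
move: B1 B2 B3; rewrite norm1_trmx (norm1_nneg n0) -/V -/H => B1 B2 B3.
have B2' : C * norm1 (v^T + n) * V <= C * (V + H) * V by rewrite ler_wpM2r // ler_wpM2l.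
have B3' : C * V * norm1 (v + nV^T) <= C * V * (V + H) by rewrite ler_wpM2l // mulr_ge0.
have L1 := ler_norm ((n *m A' *m v) 0 0).
have L2 := ler_norm (((v^T + n) *m M *m v) 0 0).
have L3 := lerNnormlW (lexx `|(v^T *m N *m (v + nV^T)) 0 0|).
have CV0 : 0 <= C * V by rewrite mulr_ge0.
have p1 : 0 <= a * V by rewrite mulr_ge0.
have p2 : 0 <= C * V * V * H by rewrite !mulr_ge0.
have p3 : 0 <= C * V by [].
lra.
Qed.

End TangentIdentity.

(** * Proper discontinuity *)

(** At [X = -3] the matrix is twice the identity, so its determinant is a nonzero
    polynomial and has finitely many roots. *)
Lemma cartan_parameter (R : realType) (k : nat) (e : rel 'I_k) (B : R) :
  exists2 x : R, B <= x & map_mx (horner_eval x) (cartan R e) \in unitmx.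
Proof.
have detE x : \det (map_mx (horner_eval x) (cartan R e)) = (\det (cartan R e)).[x].
  by rewrite det_map_mx.
have det0 : \det (cartan R e) != 0.
  apply: contraTneq isT => D0; have := detE (- 3%:R).
  have -> : map_mx (horner_eval (- 3%:R)) (cartan R e) = (2 : R)%:M.
    apply/matrixP => i j; rewrite !mxE /horner_eval; case: eqP => _.
      by rewrite -polyC_natr hornerC.
    case: ifP => _; rewrite ?horner0 // hornerN hornerD hornerX.
    by rewrite -polyC_natr hornerC subrr oppr0.
  by rewrite D0 horner0 det_scalar => /eqP; rewrite expf_eq0 (pnatr_eq0 _ 2) andbF.
pose s := [seq B + i%:R | i <- iota 0 (size (\det (cartan R e)))].
have /allPn[x /mapP[i _ ->] rx] : ~~ all (root (\det (cartan R e))) s.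
  apply/negP => /(max_poly_roots det0) H.
  have : (size s < size (\det (cartan R e)))%N.
    apply: H; rewrite map_inj_uniq ?iota_uniq // => a b /addrI /eqP.
    by rewrite eqr_nat => /eqP.
  by rewrite size_map size_iota ltnn.
by exists (B + i%:R); rewrite ?lerDl ?ler0n // unitmxE detE unitfE.
Qed.

Lemma compact_col_bounded (R : realType) n (C : set 'cV[R]_n) : compact C ->
  exists b : R, forall x, C x -> forall i, `|x i 0| <= b.
Proof.
move=> cC.
have bi (i : 'I_n) : exists b : R, forall x, C x -> `|x i 0| <= b.
  have cCi : compact [set x i 0 | x in C]%classic.
    apply: continuous_compact => //; apply: continuous_subspaceT.
    exact: coord_continuous.
  have [M [_ HM]] := compact_bounded cCi.
  exists (M + 1) => x Cx; apply: (HM (M + 1)); first by rewrite ltrDl.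
  by exists x.
pose b i := sval (cid (bi i)).
exists (\sum_i `|b i|) => x Cx i; rewrite (bigD1 i) //=.
have Hb : `|x i 0| <= b i by rewrite /b; case: cid => /= c; apply.
apply: (le_trans Hb); apply: (le_trans (ler_norm _)); rewrite lerDl.
exact: sumr_ge0.
Qed.

Section Properness.
Variables (R : realType) (k : nat) (G : groupType).
Variables (m : 'I_k -> 'I_k -> option nat) (gen : 'I_k -> G).
Hypotheses (ram : right_angled m) (pres : has_presentation gen (coxeter_rels m)).
Variable rho : G -> 'M[{poly R}]_k.
Local Notation e := (noncommuting m).
Local Notation C := (cartan R e).
Hypothesis rhoM : forall g h, rho (g * h)%g = rho g *m rho h.
Hypothesis rho1 : rho 1%g = 1%:M.
Hypothesis rho_gen : forall i, rho (gen i) = reflection R e i.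

Let esym : symmetric e := noncommuting_sym ram.
Let eirr : irreflexive e := noncommuting_irr ram.

Lemma rho_form g : (rho g)^T *m C *m rho g = C.
Proof.
have [w _ ->] := reduced_word ram pres g.
elim: w => [|j w IHw]; first by rewrite big_nil rho1 trmx1 mulmx1 mul1mx.
rewrite big_cons rhoM rho_gen trmx_mul -[in RHS]IHw -!mulmxA; congr (_ *m _).
by rewrite !mulmxA (tr_reflection_cartan R esym) -(mulmxA C) reflectionK mulmx1.
Qed.

(** Firing a letter multiplies the row by its reflection on the right, that is,
    multiplies the inverse of the group element by the letter. *)
Lemma value_rho w : value R e w = const_mx 1 *m rho ((\prod_(j <- w) gen j)^-1)%g.
Proof.
elim: w => [|j w IHw] /=; first by rewrite big_nil invg1 rho1 mulmx1.
by rewrite IHw big_cons invgM rhoM (genV ram pres) rho_gen mulmxA.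
Qed.

Variable x : R.
Local Notation ev := (map_mx (horner_eval x)).
Let A := ev C.
Let A' := deriv_at x C.
Let r g := ev (rho g).
Let d g := deriv_at x (rho g).

Lemma cartan_at_trmx : A^T = A.
Proof. by rewrite /A map_trmx cartanT. Qed.

Lemma deriv_cartan_trmx : A'^T = A'.
Proof. by rewrite /A' /deriv_at map_trmx cartanT. Qed.

Lemma rho_atM g h : r (g * h)%g = r g *m r h.
Proof. by rewrite /r rhoM map_mxM. Qed.

Lemma rho_at1 : r 1%g = 1%:M.
Proof. by rewrite /r rho1 map_mx1. Qed.

Lemma deriv_rhoM g h : d (g * h)%g = d g *m r h + r g *m d h.
Proof. by rewrite /d rhoM deriv_at_mulmx. Qed.

Lemma rho_at_form g : (r g)^T *m A *m r g = A.
Proof. by rewrite /r /A map_trmx -!map_mxM rho_form. Qed.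

Lemma deriv_rho_form g :
  (d g)^T *m A *m r g + (r g)^T *m A' *m r g + (r g)^T *m A *m d g = A'.
Proof.
rewrite /A' -[in RHS](rho_form g) !deriv_at_mulmx map_mxM mulmxDl.
by rewrite /d /r /deriv_at !map_trmx.
Qed.

Definition tangent_rho : G -> _ -> _ := tangent_action A A' r d.

Lemma tangent_rho_affine : affine_action tangent_rho.
Proof.
exact: tangent_action_affine_action cartan_at_trmx deriv_cartan_trmx rho_atM
  rho_at1 deriv_rhoM rho_at_form deriv_rho_form.
Qed.

Hypotheses (x1 : 1 <= x) (xk : (16 * k)%:R ^+ 2 <= x + 2) (Aunit : A \in unitmx).
Local Notation one := (const_mx 1 : 'rV[R]_k).

(** The game is played along a reduced word of the inverse, so that it computes
    [one *m r g] rather than [one *m r g^-1]. *)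
Lemma fired_coordinates g : exists w,
  let n := ev (firing_vector R e w) in
  [/\ reduced e w, (g^-1 = \prod_(j <- w) gen j)%g, forall i, 0 <= n 0 i,
      one *m r g = one - n *m A
    & one *m d g = - (deriv_at x (firing_vector R e w) *m A + n *m A')].
Proof.
have [w redw gw] := reduced_word ram pres g^-1%g; exists w => n.
have x0 : 0 <= x := le_trans ler01 x1.
have vE : const_mx 1 *m rho g = const_mx 1 - firing_vector R e w *m C.
  by rewrite -[g]invgK gw -value_rho value_firing_vector.
have one_ev : ev (const_mx 1 : 'rV_k) = one.
  by rewrite map_const_mx /horner_eval hornerC.
split=> // [i||].
- have := coef_le_horner x0 (firing_vector_ge0 R esym eirr i redw).
  by rewrite horner0 mxE.
- by rewrite -one_ev /r /n /A -!map_mxM vE map_mxB.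
- have one_d : deriv_at x (const_mx 1 : 'rV_k) = 0.
    by apply/rowP => i; rewrite !mxE derivC horner0.
  have := congr1 (@deriv_at R x 1 k) vE.
  by rewrite deriv_at_sub !deriv_at_mulmx one_d mul0mx !add0r one_ev.
Qed.

(** The compact set bounds the derivative of [weight R e w] by a multiple of
    [1 + weight R e w], while the game forces it far above [weight R e w] for long
    words. *)
Lemma tangent_rho_lengths c : exists B : nat, forall g M N,
  N *m r g = (r g^-1%g)^T *m M + A *m d g ->
  (forall i j, `|M i j| <= c) -> (forall i j, `|N i j| <= c) ->
  exists2 w, (size w <= B)%N & g = ((\prod_(j <- w) gen j)^-1)%g.
Proof.
have x0 : 0 <= x := le_trans ler01 x1.
have Av : A *m (- invmx A *m one^T) = - one^T.
  by rewrite mulNmx mulmxN mulmxA mulmxV // mul1mx.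
have [Q Q0 HQ] :=
  tangent_bound A' d cartan_at_trmx Aunit rho_atM rho_at1 rho_at_form Av c.
have [B HB] := growth_bound x0 Q0 (ler0n R (4 * k)).
exists (Num.bound (Num.max B 0)) => g M N MN Mc Nc.
have [w [redw gw n0 rn dn]] := fired_coordinates g.
have [wV [redwV gwV nV0 rnV _]] := fired_coordinates g^-1%g.
exists w; last by rewrite -gw invgK.
have /= := HQ g _ _ _ M N rn rnV dn MN n0 nV0 Mc Nc.
have -> : \sum_i deriv_at x (firing_vector R e w) 0 i = (weight R e w)^`().[x].
  by rewrite raddf_sum horner_sum; apply: eq_bigr => i _; rewrite mxE.
have -> : \sum_i (ev (firing_vector R e w)) 0 i = (weight R e w).[x].
  by rewrite horner_sum; apply: eq_bigr => i _; rewrite mxE.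
have W0 : 0 <=c weight R e w.
  by apply: coef_sum_ge0 => i _; exact: firing_vector_ge0.
have szw := coef_le_horner x0 (size_le_weight R esym eirr redw).
rewrite -polyC_natr hornerC in szw.
move=> /(HB _ _ _ (fun D => deriv_horner_lower D W0 x1)) H.
have {H} := H (weight_sqrt esym eirr redw x0 xk).
have Wx : 0 <= (weight R e w).[x] by apply: le_trans szw.
move=> /(_ Wx) HBw; rewrite -(ler_nat R) ltW //.
apply: le_lt_trans szw _; apply: le_lt_trans HBw _.
by apply: le_lt_trans (archi_boundP _); rewrite le_max lexx ?orbT.
Qed.

Lemma tangent_rho_proper : properly_discontinuous tangent_rho.
Proof.
move=> K cK; have [b Kb] := compact_col_bounded cK.
pose c := ((k * (k - 1)) %/ 2)%:R * b + norm1 (2^-1 *: A').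
have formc y : K y -> forall i j, `|tangent_form A' y i j| <= c.
  have subE (S T : 'M[R]_k) i j : (S - T) i j = S i j - T i j by rewrite !mxE.
  move=> Ky i j; rewrite /tangent_form subE; apply: le_trans (ler_normB _ _) _.
  by apply: lerD; [exact: skew_bound (Kb y Ky) | exact: entry_le_norm1].
have [B HB] := tangent_rho_lengths c.
pose elt (w : B.-bseq 'I_k) := ((\prod_(j <- w) gen j)^-1)%g.
apply: (@sub_finite_set _ _ (range elt)).
  move=> g /= [_ [[y Ky <-] KTy]].
  have FE := form_tangent_action cartan_at_trmx deriv_cartan_trmx rho_atM rho_at1
    deriv_rho_form g y.
  have [|w sw ->] := HB g _ (tangent_form A' (tangent_rho g y)) _
    (formc _ Ky) (formc _ KTy).
    by rewrite /tangent_rho FE form_act_mulr //; [exact: rho_atM | exact: rho_at1].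
  by exists (Bseq sw).
exact/finite_image/finite_finset.
Qed.

End Properness.

Theorem theorem1p1 (R : realType) (k : nat) (Gamma : groupType)
    (hGamma : right_angled_Coxeter_group k Gamma) :
  exists rho : Gamma -> 'cV[R]_((k * (k - 1)) %/ 2) -> 'cV[R]_((k * (k - 1)) %/ 2),
    affine_action rho /\ properly_discontinuous rho.
Proof.
have [m [gen [ram pres]]] := hGamma.
have [rho [rhoM rho1 rho_gen]] := reflection_representation R ram pres.
have [x Bx Aunit] := cartan_parameter (noncommuting m) ((16 * k)%:R ^+ 2 + 1 : R).
have sq0 : 0 <= (16 * k)%:R ^+ 2 :> R by exact: sqr_ge0.
have x1 : 1 <= x by lra.
have xk : (16 * k)%:R ^+ 2 <= x + 2 by lra.
exists (tangent_rho m rho x); split.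
  exact (tangent_rho_affine ram pres rhoM rho1 rho_gen x).
exact (tangent_rho_proper ram pres rhoM rho1 rho_gen x1 xk Aunit).
Qed.
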